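(* Let $P$ and $Q$ be probability distributions on $\mathsf Z$, and let $a_P,a_Q\in\mathsf A$ satisfy $H_\ell(P)=\mathbb E_P[\ell(Z,a_P)]$ and $H_\ell(Q)=\mathbb E_Q[\ell(Z,a_Q)]$. (i) If $\ell(Z,a_Q)$ is $\sigma_Q^2$-subgaussian under $Q$, then $H_\ell(P)-H_\ell(Q)\le\sqrt{2\sigma_Q^2D(P\|Q)}$. If $\ell(Z,a_P)$ is $\sigma_P^2$-subgaussian under $Q$, then $H_\ell(Q)-H_\ell(P)\le\sqrt{2\sigma_P^2D(P\|Q)}$. (ii) More generally, if there is a function $\varphi_Q:[0,b_Q)\to\mathbb R$ with some $b_Q\in(0,\infty]$ such that $$\log\mathbb E_Q\big[e^{\lambda(\ell(Z,a_Q)-\mathbb E_Q[\ell(Z,a_Q)])}\big]\le\varphi_Q(\lambda)\quad\text{for all }0\le\lambda<b_Q,$$ then $H_\ell(P)-H_\ell(Q)\le\varphi_Q^{*-1}(D(P\|Q))$. If there is a function $\varphi_P:[0,b_P)\to\mathbb R$ with some $b_P\in(0,\infty]$ such that $$\log\mathbb E_Q\big[e^{-\lambda(\ell(Z,a_P)-\mathbb E_Q[\ell(Z,a_P)])}\big]\le\varphi_P(\lambda)\quad\text{for all }0\le\lambda<b_P,$$ then $H_\ell(Q)-H_\ell(P)\le\varphi_P^{*-1}(D(P\|Q))$. Here, for $i\in\{P,Q\}$, $\varphi_i^*(\gamma)=\sup_{0\le\lambda<b_i}\big(\lambda\gamma-\varphi_i(\lambda)\big)$ for $\gamma\in\mathbb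 R$, and $\varphi_i^{*-1}(x)=\sup\{\gamma\in\mathbb R:\varphi_i^*(\gamma)\le x\}$ for $x\in\mathbb R$. (iii) In addition, for $i\in\{P,Q\}$, if $\varphi_i$ is strictly convex over $(0,b_i)$ and $\varphi_i(0)=\varphi_i'(0)=0$, then $\lim_{x\downarrow0}\varphi_i^{*-1}(x)=0$.
   Context: $\mathsf Z$ is a (measurable) space of outcomes, $\mathsf A$ a space of actions, $\ell:\mathsf Z\times\mathsf A\to\mathbb R$ a loss function. The generalized entropy of a distribution $P$ on $\mathsf Z$ is $H_\ell(P)=\inf_{a\in\mathsf A}\mathbb E_P[\ell(Z,a)]$, $Z\sim P$. It is assumed that the infimum is attained for the distributions considered, and that the expectations appearing are well defined. A random variable $U$ is $\sigma^2$-subgaussian if $\mathbb E[e^{\lambda(U-\mathbb EU)}]\le e^{\lambda^2\sigma^2/2}$ for all $\lambda\in\mathbb R$. $D(P\|Q)$ is the KL divergence (natural logarithm); the bounds are trivial when it is infinite. $\varphi'(0)$ is the right derivative at $0$. *)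

(* Defs.v *)
From HB Require Import structures.
From mathcomp Require Export all_boot all_order all_algebra.
From mathcomp Require Export all_classical all_reals all_analysis.

Set Implicit Arguments.
Unset Strict Implicit.
Unset Printing Implicit Defensive.

Import Order.TTheory GRing.Theory Num.Theory.
Import numFieldNormedType.Exports.

Local Open Scope classical_set_scope.
Local Open Scope ring_scope.
Local Open Scope ereal_scope.
Local Open Scope charge_scope.

Section information.
Context (d : measure_display) (T : measurableType d) (R : realType).
Implicit Types (P Q : probability T R) (U : T -> R).

(* The expectation of U exists in [-oo, +oo]: the positive and the negative
   part do not both have an infinite integral. *)
Definition expectation_defined P U : Prop :=
  measurable_fun setT U /\
  (\int[P]_z (EFin \o U)^\+ z < +oo \/ \int[P]_z (EFin \o U)^\- z < +oo).

(* The integrand is +oo/-oo only on a P-negligible set, and its negative part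
   is always P-integrable, so the integral is defined whenever P `<< Q. *)
Definition kl_divergence P Q : \bar R :=
  if `[< P `<< Q >] then
    \int[P]_z lne ('d (charge_of_finite_measure P) '/d Q z)
  else +oo.

(* Logarithmic moment generating function of U - E_Q[U], for U integrable
   under Q; lne +oo = +oo when the exponential moment is infinite. *)
Definition centered_cgf Q U (lambda : R) : \bar R :=
  lne 'E_Q[fun z => expR (lambda * (U z - fine 'E_Q[U]))].

Definition subgaussian Q U (sigma2 : R) : Prop :=
  Q.-integrable setT (EFin \o U) /\
  forall lambda : R,
    'E_Q[fun z => expR (lambda * (U z - fine 'E_Q[U]))]
    <= (expR (lambda ^+ 2 * sigma2 / 2))%:E.

End information.

Definition generalized_entropy (d : measure_display) (Z : measurableType d)
    (A : Type) (R : realType) (l : Z -> A -> R) (P : probability Z R) :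
    \bar R :=
  ereal_inf [set 'E_P[fun z => l z a] | a in [set: A]].

Section conjugate.
Context (R : realType).
Implicit Types (phi : R -> R) (b : \bar R).

(* A function on [0, b) is represented by phi : R -> R, of which only the
   values at 0 <= lambda < b are used. *)
Definition conjugate b phi (gamma : R) : \bar R :=
  ereal_sup [set (lambda * gamma - phi lambda)%:E |
             lambda in [set lambda : R | (0 <= lambda)%R /\ lambda%:E < b]].

(* The supremum of the empty set is -oo. *)
Definition conjugate_inv b phi (x : R) : \bar R :=
  ereal_sup [set gamma%:E |
             gamma in [set gamma : R | conjugate b phi gamma <= x%:E]].

Definition strictly_convex_on0 b phi : Prop :=
  forall x y t : R, (0 < x)%R -> x%:E < b -> (0 < y)%R -> y%:E < b ->
    x != y -> (0 < t < 1)%R ->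
    (phi (t * x + (1 - t) * y) < t * phi x + (1 - t) * phi y)%R.

Definition is_right_derivative0 phi (l : R) : Prop :=
  ((phi h - phi 0) / h)%R @[h --> (0 : R)^'+] --> l.

(* A bound given as a function of a finite divergence is trivial (+oo) when
   the divergence is infinite; in particular the convention 0 * +oo = 0 does
   not come into play. *)
Definition bound_at (bound : R -> \bar R) (D : \bar R) : \bar R :=
  if D is x%:E then bound x else +oo.

End conjugate.

(* Main.v *)
(** Let [L] be the log-likelihood ratio [ln (dP/dQ)]. For every [V] and [c], the
    inequality [1 + x <= exp x] at [x = V - c - L] gives
    [V <= c + L + exp (V - c - L) - 1] pointwise, and
    [E_P (exp (V - c - L)) <= exp (- c) * E_Q (exp V)]. Integrating under [P],
    [E_P V <= D(P||Q) + c] as soon as [E_Q (exp V) <= exp c] (Donsker-Varadhan).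
    With [V = lambda (U - E_Q U)] and [c = phi lambda], this says that the
    conjugate of [phi] at [E_P U - E_Q U] is at most [D(P||Q)]. The gaps between
    entropies are of this form, for [U = l(., aQ)] and [U = - l(., aP)], because
    each entropy is at most the risk of the action optimal for the other
    distribution. The subgaussian bounds are the case
    [phi lambda = lambda^2 sigma^2 / 2].

    For the limit, [phi >= 0] by convexity, hence [0 <= phi^{*-1}(x)] for [x >= 0],
    and [phi^{*-1}(x) <= (x + phi h) / h] for every [h] in [(0, b)], which is small
    for suitable [h] and small [x] because [phi h = o(h)]. *)

Require Import Defs.
From mathcomp Require Import all_boot all_order all_algebra.
From mathcomp Require Import all_classical all_reals all_analysis.
From mathcomp Require Import measurable_realfun ring lra.
Set Implicit Arguments.
Unset Strict Implicit.
Import Order.TTheory GRing.Theory Num.Theory.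
Import numFieldNormedType.Exports.
Local Open Scope classical_set_scope.
Local Open Scope ring_scope.
Local Open Scope ereal_scope.

(** * Likelihood ratio and the Donsker-Varadhan inequality *)

(** [L] is [ln] of an everywhere finite, nonnegative version [g] of dP/dQ. The change of measure is
    only an inequality: its left side is the integral of [h] under Q over the set where [g > 0]. *)
Lemma log_likelihood_ratio (R : realType) (d : measure_display)
    (Z : measurableType d) (P Q : probability Z R) : P `<< Q ->
  exists L : Z -> R, [/\ measurable_fun setT L,
    kl_divergence P Q = \int[P]_z (L z)%:E &
    forall h : Z -> R, measurable_fun setT h -> (forall z, (0 <= h z)%R) ->
      \int[P]_z (h z * expR (- L z))%:E <= \int[Q]_z (h z)%:E].
Proof.
move=> PQ.
pose f := Radon_Nikodym_SigmaFinite.f P Q.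
pose g z := fine (f z).
have fin_f z : f z \is a fin_num by exact: Radon_Nikodym_SigmaFinite.f_fin_num.
have fE z : f z = (g z)%:E by rewrite /g fineK.
have f0 z : 0 <= f z by exact: Radon_Nikodym_SigmaFinite.f_ge0.
have g0 z : (0 <= g z)%R by rewrite -lee_fin -fE.
have mf : measurable_fun setT f.
  by apply: measurable_int; exact: Radon_Nikodym_SigmaFinite.f_integrable.
have mg : measurable_fun setT g by apply: (measurableT_comp _ mf); exact: fine_measurable.
have mlng : measurable_fun setT (fun z => ln (g z)).
  by apply: measurableT_comp mg; exact: measurable_ln.
have g_gt0 : {ae P, forall z, (0 < g z)%R}.
  exists (g @^-1` [set 0%R]); split.
  - by rewrite -[X in measurable X]setTI; apply: mg.
  - rewrite (Radon_Nikodym_SigmaFinite.f_integral PQ); last first.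
      by rewrite -[X in measurable X]setTI; apply: mg.
    apply: integral0_eq => z /= gz0.
    by rewrite -/f fE gz0.
  - by move=> z /= /negP; rewrite -leNgt => gz; apply/eqP; rewrite eq_le gz g0.
exists (fun z => ln (g z)); split => //.
- rewrite /kl_divergence asboolT//.
  set rn := Radon_Nikodym _ _.
  have fin_rn z : rn z \is a fin_num by exact: Radon_Nikodym_fin_num.
  have mrn : measurable_fun setT (fine \o rn).
    apply: measurableT_comp => //.
    exact/measurable_int/Radon_Nikodym_integrable.
  apply: ae_eq_integral => //.
  + rewrite (_ : (fun z => _) = fun z =>
      if ((fine \o rn) z <= 0)%R then -oo else (ln (fine (rn z)))%:E); last first.
      by apply/funext => z; rewrite -[in LHS](fineK (fin_rn z)).
    apply: measurable_fun_ifT => //.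
    * exact: measurable_fun_ler.
    * apply/measurable_EFinP; apply: (measurableT_comp (@measurable_ln R)) => //.
  + exact/measurable_EFinP.
  (* The density inside [kl_divergence] agrees with [f] only Q-almost everywhere; absolute
     continuity transfers this to P. *)
  + have : ae_eq Q setT f rn by exact: ae_eq_Radon_Nikodym_SigmaFinite.
    move/(null_dominates_ae_eq measurableT PQ) => frn.
    near=> z => _.
    have <- : f z = rn z by near: z; apply: filterS frn => z /(_ I).
    by rewrite fE lne_EFin//; near: z.
- move=> h mh h0.
  have he0 z : 0 <= (h z * expR (- ln (g z)))%:E by rewrite lee_fin mulr_ge0 ?expR_ge0.
  have mhe : measurable_fun setT (fun z => (h z * expR (- ln (g z)))%:E).
    apply/measurable_EFinP/measurable_funM => //.
    by apply: measurableT_comp => //; exact: measurableT_comp.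
  rewrite -(Radon_Nikodym_SigmaFinite.change_of_variables PQ)//.
  apply: ge0_le_integral => //.
  + by move=> z _; rewrite mule_ge0// -/f f0.
  + by apply: emeasurable_funM.
  + exact/measurable_EFinP.
  + move=> z _; rewrite -/f fE -EFinM lee_fin -mulrA.
    (* At a zero of [g] the left side vanishes, whatever the value of [ln 0]. *)
    have [<-|gz] := eqVneq 0%R (g z); first by rewrite !mulr0.
    have {}gz : (0 < g z)%R by rewrite lt_neqAle gz g0.
    by rewrite expRN lnK// mulVf ?mulr1// gt_eqF.
Unshelve. all: by end_near. Qed.

Lemma probability_integral_cst (R : realType) (d : measure_display)
    (Z : measurableType d) (P : probability Z R) (x : \bar R) :
  \int[P]_z x = x.
Proof. by rewrite integral_cst// [X in _ * X]probability_setT mule1. Qed.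

(** The majorant [B = L + w + c - 1] of [V] is P-integrable, so the positive part of [V] always has
    a finite integral. The negative part may not, which is why the inequality between integrals is
    conditional. *)
Lemma donsker_varadhan (R : realType) (d : measure_display)
    (Z : measurableType d) (P Q : probability Z R) (D c : R) (V : Z -> R) :
  kl_divergence P Q = D%:E -> measurable_fun setT V ->
  \int[Q]_z (expR (V z))%:E <= (expR c)%:E ->
  \int[P]_z (EFin \o V)^\+ z < +oo /\
  (P.-integrable setT (EFin \o V) -> \int[P]_z (V z)%:E <= (D + c)%:E).
Proof.
move=> klD mV cV.
have [PQ|nPQ] := pselect (P `<< Q); last by move: klD; rewrite /kl_divergence asboolF.
have [L [mL klL leL]] := log_likelihood_ratio PQ.
(* Since +oo - +oo is -oo by convention, a finite value of the integral already forces
   integrability. *)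
have intL : P.-integrable setT (EFin \o L).
  apply/integrableP; split; first exact/measurable_EFinP.
  by rewrite integral_fin_num_abs// -klL klD.
pose w z := (expR (V z - c - L z))%R.
have mw : measurable_fun setT w.
  by apply: measurableT_comp => //; do 2 apply: measurable_funB => //.
have w1 : \int[P]_z (w z)%:E <= 1.
  have mVc : measurable_fun setT (fun z => expR (V z - c)).
    by apply: measurableT_comp => //; exact: measurable_funB.
  have := leL _ mVc (fun z => expR_ge0 _).
  under eq_integral do rewrite -expRD.
  move=> /le_trans; apply.
  under eq_integral do rewrite expRD mulrC EFinM.
  have mexpV : measurable_fun setT (fun z => (expR (V z))%:E).
    by apply/measurable_EFinP; exact: measurableT_comp.
  rewrite ge0_integralZl ?lee_fin ?expR_ge0//.
  by rewrite expRN lee_pdivrMl ?expR_gt0// mule1.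
have intw : P.-integrable setT (EFin \o w).
  apply/integrableP; split; first exact/measurable_EFinP.
  rewrite integral_fin_num_abs// ge0_fin_numE ?(le_lt_trans w1) ?ltry//.
  by apply: integral_ge0 => z _; rewrite lee_fin expR_ge0.
pose B z := (L z + w z + (c - 1))%R.
have cint (r : R) : P.-integrable setT (EFin \o cst r) by exact: finite_measure_integrable_cst.
have BE : EFin \o B = ((EFin \o L) \+ (EFin \o w)) \+ (EFin \o cst (c - 1)%R).
  by apply/funext => z.
have intB : P.-integrable setT (EFin \o B) by rewrite BE; do 2 apply: integrableD => //.
have VB z : (V z <= B z)%R.
  have := expR_ge1Dx (V z - c - L z).
  rewrite /B /w; lra.
split.
  apply: le_lt_trans (integral_funepos_lt_pinfty measurableT intB).
  apply: ge0_le_integral => //.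
  - exact/measurable_funepos/measurable_EFinP.
  - by apply: measurable_funepos; exact: measurable_int intB.
  - by move=> z _; apply: (@funepos_le _ _ setT); rewrite ?inE// => x _; rewrite lee_fin.
move=> intV.
apply: (@le_trans _ _ (\int[P]_z (B z)%:E)).
  by apply: le_integral => // z _; rewrite lee_fin.
rewrite -/(EFin \o B) BE.
rewrite integralD//; last exact: integrableD.
rewrite integralD//= -klL klD probability_integral_cst.
rewrite -addeA [leRHS]EFinD leeD2l//.
apply: le_trans (leeD2r _ w1) _.
by rewrite -EFinD lee_fin; lra.
Qed.

(** * Inverse of the conjugate and its quadratic case *)

Lemma exists_EFin_between0 (R : realType) (b : \bar R) : 0 < b ->
  exists2 x : R, (0 < x)%R & x%:E < b.
Proof.
case: b => [b| |]//; last by exists 1%R => //; exact: ltry.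
rewrite lte_fin => b0; exists (b / 2)%R; first by rewrite divr_gt0.
by rewrite lte_fin ltr_pdivrMr// mulrDr mulr1 ltrDl.
Qed.

Lemma le_conjugate_inv (R : realType) (b : \bar R) (phi : R -> R) (x gamma : R) :
  conjugate b phi gamma <= x%:E -> gamma%:E <= conjugate_inv b phi x.
Proof. by move=> h; apply: ereal_sup_ubound; exists gamma. Qed.

Lemma conjugate_inv_le (R : realType) (b : \bar R) (phi : R -> R) (x : R)
    (y : \bar R) :
  (forall gamma : R, (forall lambda : R, (0 <= lambda)%R -> lambda%:E < b ->
     (lambda * gamma - phi lambda <= x)%R) -> gamma%:E <= y) ->
  conjugate_inv b phi x <= y.
Proof.
move=> H; apply: ge_ereal_sup => _ [gamma /= hg <-]; apply: H => lambda l0 lb.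
by rewrite -lee_fin (le_trans _ hg)//; apply: ereal_sup_ubound; exists lambda.
Qed.

(** For [s > 0], [lambda = gamma / s] maximizes [lambda * gamma - lambda ^+ 2 * s / 2], with value
    gamma^2 / (2 s); comparison with [x] bounds gamma^2 by 2 s x. *)
Lemma conjugate_inv_quadratic_le (R : realType) (s x : R) : (0 <= s)%R ->
  conjugate_inv +oo (fun lambda => lambda ^+ 2 * s / 2)%R x
  <= (Num.sqrt (2 * s * x))%:E.
Proof.
move=> s0; apply: conjugate_inv_le => gamma H; rewrite lee_fin.
have {}H (lambda : R) : (0 <= lambda)%R ->
    (lambda * gamma - lambda ^+ 2 * s / 2 <= x)%R.
  by move=> l0; apply: H => //; exact: ltry.
have [g0|g0] := leP gamma 0%R; first by apply: (le_trans g0); exact: sqrtr_ge0.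
(* For [s = 0] no positive [gamma] is admissible: [lambda = (x + 1) / gamma] would give
   [x + 1 <= x]. The choice [lambda = 0] first yields [0 <= x], so that this witness is
   nonnegative. *)
have [s_eq0|s_neq0] := eqVneq s 0%R.
  have x0 : (0 <= x)%R by have := H _ (lexx _); rewrite mul0r expr0n !mul0r subr0.
  have := H ((x + 1) / gamma)%R; rewrite divr_ge0 ?addr_ge0 ?(ltW g0)// => /(_ isT).
  by rewrite s_eq0 mulr0 mul0r subr0 divfK ?gt_eqF//; lra.
have {s_neq0}s0 : (0 < s)%R by rewrite lt_neqAle eq_sym s_neq0.
have := H (gamma / s)%R; rewrite divr_ge0 ?(ltW s0) ?(ltW g0)// => /(_ isT) Hg.
rewrite -[leLHS]ger0_norm ?(ltW g0)// -sqrtr_sqr; apply: ler_wsqrtr.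
have -> : (gamma ^+ 2 =
    2 * s * (gamma / s * gamma - (gamma / s) ^+ 2 * s / 2))%R.
  by field; rewrite gt_eqF.
by rewrite ler_pM2l// mulr_gt0.
Qed.

(** * Behaviour of the inverse conjugate at 0 *)

(** The estimate is two-sided and covers a whole interval because the convexity argument uses an
    upper bound at [h / 2] and a lower bound at [h]. The parameter [y] keeps [h] inside the domain
    of [phi]. *)
Lemma right_derivative0_small (R : realType) (phi : R -> R) :
  phi 0%R = 0%R -> is_right_derivative0 phi 0 -> forall eps y : R,
  (0 < eps)%R -> (0 < y)%R -> exists2 h : R, (0 < h < y)%R &
    forall x, (0 < x <= h)%R -> (`|phi x| <= eps * x)%R.
Proof.
move=> phi0 /cvgrPdist_le D eps y /D + y0.
rewrite near_withinE => -[/= delta d0 hd].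
have min0 : (0 < Num.min delta y)%R by rewrite lt_min d0.
have hmin : (Num.min delta y / 2 < Num.min delta y)%R by lra.
exists (Num.min delta y / 2)%R.
  by rewrite divr_gt0//= (lt_le_trans hmin)// ge_min lexx orbT.
move=> x /andP[x0 xh].
have xdelta : (x < delta)%R.
  by rewrite (le_lt_trans xh)// (lt_le_trans hmin)// ge_min lexx.
have := hd x; rewrite /= sub0r normrN gtr0_norm// => /(_ xdelta x0).
by rewrite phi0 subr0 sub0r normrN normrM normfV (gtr0_norm x0) ler_pdivrMr.
Qed.

(** Convexity is assumed on the open interval alone, so the chord starts at [h / 2], a stand-in for
    0 where the vanishing derivative controls [phi]. *)
Lemma strictly_convex_ge0 (R : realType) (b : \bar R) (phi : R -> R) :
  strictly_convex_on0 b phi -> phi 0%R = 0%R -> is_right_derivative0 phi 0 ->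
  forall y : R, (0 <= y)%R -> y%:E < b -> (0 <= phi y)%R.
Proof.
move=> cvx phi0 /(right_derivative0_small phi0) small y.
rewrite le_eqVlt => /predU1P[<- _|y0 yb]; first by rewrite phi0.
rewrite leNgt; apply/negP => phiy.
(* On [0, h], |phi x| <= eps x = - phi y / (4 y) x; the chord from h/2 to y
   then lies below - eps h at h, contradicting convexity. *)
pose eps := (- phi y / (4 * y))%R.
have eps0 : (0 < eps)%R by rewrite divr_gt0 ?oppr_gt0 ?mulr_gt0.
have epsE : (phi y = - (4 * y * eps))%R by rewrite /eps; field; rewrite gt_eqF.
have [h /andP[h0 hy] hd] := small _ _ eps0 y0.
have := hd h; rewrite h0 lexx => /(_ isT); rewrite ler_norml => /andP[hl _].
have h2h : (h / 2 <= h)%R by lra.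
have := hd (h / 2)%R; rewrite divr_gt0//= h2h => /(_ isT).
rewrite ler_norml => /andP[_ hr].
pose t := ((y - h) / (y - h / 2))%R.
have yh2 : (0 < y - h / 2)%R by lra.
have t0 : (0 < t)%R by rewrite divr_gt0// subr_gt0.
have t1 : (t < 1)%R by rewrite ltr_pdivrMr// mul1r; lra.
have tE : (t * (h / 2) + (1 - t) * y = h)%R.
  by rewrite /t; field; lra.
have := cvx (h / 2)%R y t; rewrite tE divr_gt0// t0 t1 y0 yb.
have h2b : (h / 2)%:E < b by rewrite (lt_trans _ yb)// lte_fin; lra.
have h2y : (h / 2 != y)%R by rewrite lt_eqF//; lra.
rewrite h2b h2y => /(_ isT isT isT isT isT isT).
have t'E : ((1 - t) * (y - h / 2) = h / 2)%R by rewrite /t; field; lra.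
rewrite ltNge => /negP; apply.
(* The two bounds below add up to [eps * h / 2 - 2 * eps * h], that is -3/2 of [eps * h], which is
   below the lower bound [- eps * h] for [phi h]. *)
have : (t * phi (h / 2) <= eps * (h / 2))%R.
  rewrite (@le_trans _ _ (t * (eps * (h / 2)))%R)//.
    by rewrite ler_pM2l.
  by rewrite ger_pMl ?(ltW t1)// mulr_gt0// divr_gt0.
have : ((1 - t) * phi y <= - 4 * eps * (h / 2))%R.
  have t1' : (0 < 1 - t)%R by rewrite subr_gt0.
  have := mulr_gt0 (mulr_gt0 eps0 t1') h0.
  by rewrite epsE -t'E; lra.
by have := mulr_gt0 eps0 h0; lra.
Qed.

Lemma conjugate_inv_cvg0 (R : realType) (b : \bar R) (phi : R -> R) : 0 < b ->
  strictly_convex_on0 b phi -> phi 0%R = 0%R -> is_right_derivative0 phi 0 ->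
  conjugate_inv b phi x @[x --> (0 : R)^'+] --> (0 : \bar R).
Proof.
move=> b0 cvx phi0 dphi.
have ge0 := strictly_convex_ge0 cvx phi0 dphi.
have small eps : (0 < eps)%R -> \forall x \near (0 : R)^'+,
    0 <= conjugate_inv b phi x <= eps%:E.
  move=> eps0.
  have [y y0 yb] := exists_EFin_between0 b0.
  (* One half of [eps] pays for [phi h / h], the other for [x / h]. *)
  have [h /andP[h0 hy] hd] :=
    right_derivative0_small phi0 dphi (divr_gt0 eps0 (ltr0Sn _ 1)) y0.
  have := hd h; rewrite h0 lexx => /(_ isT); rewrite ler_norml => /andP[_ hr].
  near=> x.
  have x0 : (0 < x)%R by near: x; exact: nbhs_right_gt.
  have xh : (x < eps / 2 * h)%R.
    by near: x; apply: nbhs_right_lt; rewrite mulr_gt0// divr_gt0.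
  apply/andP; split.
    (* [gamma = 0] is admissible: the conjugate at 0 is the supremum of [- phi], at most 0. *)
    apply: le_conjugate_inv; apply: ge_ereal_sup => _ [l [l0 lb] <-].
    by rewrite lee_fin mulr0 sub0r (le_trans _ (ltW x0))// oppr_le0 ge0.
  apply: conjugate_inv_le => gamma /(_ h (ltW h0)).
  rewrite (lt_trans _ yb) ?lte_fin// => /(_ isT) Hg.
  by rewrite lee_fin -(ler_pM2l h0); lra.
apply/fine_cvgP; split.
  have := small 1%R ltr01; apply: filterS => x /andP[x0 x1].
  by rewrite ge0_fin_numE// (le_lt_trans x1)// ltry.
apply/cvgrPdist_le => eps /small; apply: filterS => x /andP[x0 x1] /=.
have fx : conjugate_inv b phi x \is a fin_num.
  by rewrite ge0_fin_numE// (le_lt_trans x1)// ltry.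
by rewrite sub0r normrN ger0_norm ?fine_ge0// -lee_fin fineK.
Unshelve. all: by end_near. Qed.

(** * Cumulant generating functions and gaps between expectations *)

Lemma centered_cgf_le (R : realType) (d : measure_display)
    (Z : measurableType d) (Q : probability Z R) (U : Z -> R) (lambda c : R) :
  centered_cgf Q U lambda <= c%:E <->
  'E_Q[fun z => expR (lambda * (U z - fine 'E_Q[U]))] <= (expR c)%:E.
Proof.
have E0 : 0 <= 'E_Q[fun z => expR (lambda * (U z - fine 'E_Q[U]))].
  by apply: expectation_ge0 => z; exact: expR_ge0.
by rewrite -lee_expeR lneK// in_itv/= E0 leey.
Qed.

(** Because +oo - +oo is -oo, negation would fail to commute with the integral if both parts were
    infinite. *)
Lemma expectationN (R : realType) (d : measure_display)
    (Z : measurableType d) (P : probability Z R) (U : Z -> R) :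
  expectation_defined P U -> 'E_P[fun z => (- U z)%R] = - 'E_P[U].
Proof.
move=> [_ defU]; rewrite unlock.
under eq_integral do rewrite EFinN.
apply: integralN.
have p0 : 0 <= \int[P]_z (EFin \o U)^\+ z by exact: integral_ge0.
have n0 : 0 <= \int[P]_z (EFin \o U)^\- z by exact: integral_ge0.
by case: defU => h; [apply: fin_num_adde_defr|apply: fin_num_adde_defl];
  rewrite ?fin_numN ge0_fin_numE.
Qed.

Lemma integrable_expectation_defined (R : realType) (d : measure_display)
    (Z : measurableType d) (P : probability Z R) (U : Z -> R) :
  P.-integrable setT (EFin \o U) -> expectation_defined P U.
Proof.
move=> intU; split; first by move/measurable_int/measurable_EFinP : intU.
by left; exact: integral_funepos_lt_pinfty.
Qed.

Lemma centered_cgfN (R : realType) (d : measure_display)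
    (Z : measurableType d) (Q : probability Z R) (U : Z -> R) (lambda : R) :
  Q.-integrable setT (EFin \o U) ->
  centered_cgf Q (fun z => - U z)%R lambda = centered_cgf Q U (- lambda).
Proof.
move=> /integrable_expectation_defined/expectationN UN.
rewrite /centered_cgf UN fineN; congr (lne (expectation _ _)).
by apply/funext => z; congr expR; ring.
Qed.

(** The hypotheses on [U] concern Q only, so its expectation under P may be infinite. When the
    divergence is finite, a single exponent [y] in (0, b) excludes +oo, and -oo makes the bound
    trivial. Otherwise [U] is P-integrable, and the Donsker-Varadhan bounds at all [lambda] make the
    gap itself an admissible [gamma]. *)
Lemma expectation_gap_le (R : realType) (d : measure_display)
    (Z : measurableType d) (P Q : probability Z R) (U : Z -> R) (b : \bar R)
    (phi : R -> R) : 0 < b -> Q.-integrable setT (EFin \o U) ->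
  (forall lambda : R, (0 <= lambda)%R -> lambda%:E < b ->
     centered_cgf Q U lambda <= (phi lambda)%:E) ->
  'E_P[U] - 'E_Q[U] <= bound_at (conjugate_inv b phi) (kl_divergence P Q).
Proof.
move=> b0 intQU cgf.
case klD : (kl_divergence P Q) => [D| |] /=; [|exact: leey|exact: leey].
have mU : measurable_fun setT U by move/measurable_int/measurable_EFinP : intQU.
have finQ : 'E_Q[U] \is a fin_num by rewrite unlock integrable_fin_num.
set m := fine 'E_Q[U].
pose V (lambda : R) z := (lambda * (U z - m))%R.
have mUm : measurable_fun setT (fun z => U z - m)%R by exact: measurable_funB.
have mV lambda : measurable_fun setT (V lambda) by exact: measurable_funM.
have dv (lambda : R) : (0 <= lambda)%R -> lambda%:E < b ->
  \int[P]_z (EFin \o V lambda)^\+ z < +oo /\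
  (P.-integrable setT (EFin \o V lambda) ->
   \int[P]_z (V lambda z)%:E <= (D + phi lambda)%:E).
  move=> l0 lb; apply: donsker_varadhan klD (mV lambda) _.
  by have /centered_cgf_le := cgf _ l0 lb; rewrite -/m unlock.
have [y y0 yb] := exists_EFin_between0 b0.
have posU : \int[P]_z (EFin \o U)^\+ z < +oo.
  have [posV _] := dv _ (ltW y0) yb.
  (* Since [U] is [V y / y + m], its positive part is at most that of [V y] divided by [y], plus
     [|m|]. *)
  pose B : Z -> \bar R := fun z => y^-1%:E * (EFin \o V y)^\+ z + `|m|%:E.
  have mVp : measurable_fun setT (EFin \o V y)^\+.
    exact/measurable_funepos/measurable_EFinP.
  have Vp0 z : 0 <= (EFin \o V y)^\+ z by [].
  apply: (@le_lt_trans _ _ (\int[P]_z B z)).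
    apply: ge0_le_integral => //.
    - exact/measurable_funepos/measurable_EFinP.
    - by apply: emeasurable_funD => //; exact: measurable_funeM.
    - move=> z _.
      rewrite /B !funeposE/= ge_max; apply/andP; split; last first.
        by rewrite adde_ge0// mule_ge0 ?lee_fin ?invr_ge0 ?(ltW y0)// le_max lexx orbT.
      apply: (@le_trans _ _ (y^-1 * V y z + `|m|)%:E).
        by rewrite lee_fin /V mulKf ?gt_eqF// -lerBlDr lerB// ler_norm.
      rewrite EFinD EFinM leeD2r// lee_wpmul2l ?lee_fin ?invr_ge0 ?(ltW y0)//.
      by rewrite le_max lexx.
  rewrite ge0_integralD//; last exact: measurable_funeM.
    rewrite ge0_integralZl// ?lee_fin ?invr_ge0 ?(ltW y0)//.
    rewrite probability_integral_cst.
    by rewrite lte_add_pinfty ?ltry// lte_mul_pinfty ?lee_fin ?invr_ge0 ?(ltW y0).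
  by move=> z _; rewrite mule_ge0// lee_fin invr_ge0 ltW.
have pos0 : 0 <= \int[P]_z (EFin \o U)^\+ z by exact: integral_ge0.
have neg0 : 0 <= \int[P]_z (EFin \o U)^\- z by exact: integral_ge0.
have pfin : \int[P]_z (EFin \o U)^\+ z \is a fin_num by rewrite ge0_fin_numE.
have [negy|negfin] := eqVneq (\int[P]_z (EFin \o U)^\- z) +oo.
  have -> : 'E_P[U] = -oo by rewrite unlock integralE negy; exact: addeNy.
  by rewrite addNye leNye.
have intPU : P.-integrable setT (EFin \o U).
  apply/integrableP; split; first exact/measurable_EFinP.
  rewrite integral_fin_num_abs// integralE fin_numB pfin.
  by rewrite ge0_fin_numE// ltey.
have finP : 'E_P[U] \is a fin_num by rewrite unlock integrable_fin_num.
rewrite -(fineK finP) -(fineK finQ) -EFinB -/m.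
apply: le_conjugate_inv; apply: ge_ereal_sup => _ [lambda [l0 lb] <-].
have cint (r : R) : P.-integrable setT (EFin \o cst r).
  exact: finite_measure_integrable_cst.
have intUm : P.-integrable setT (fun z => (U z)%:E - m%:E).
  by apply: integrableB => //; exact: cint.
have VE : EFin \o V lambda = fun z => lambda%:E * ((U z)%:E - m%:E) by [].
have [_ /(_ _)] := dv _ l0 lb.
rewrite -/(EFin \o V lambda) VE integrableZl// => /(_ isT).
rewrite integralZl// integralB//; last exact: cint.
rewrite probability_integral_cst.
have <- : 'E_P[U] = \int[P]_z (U z)%:E by rewrite unlock.
rewrite -(fineK finP) -EFinB -EFinM !lee_fin; lra.
Qed.

Lemma subgaussian_centered_cgf (R : realType) (d : measure_display)
    (Z : measurableType d) (Q : probability Z R) (U : Z -> R) (s : R) :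
  subgaussian Q U s -> forall lambda, centered_cgf Q U lambda <= (lambda ^+ 2 * s / 2)%:E.
Proof. by move=> [_ H] lambda; apply/centered_cgf_le. Qed.

(** * Bounds on differences of generalized entropies *)

Lemma bound_at_le (R : realType) (f g : R -> \bar R) (x : \bar R) :
  (forall r, f r <= g r) -> bound_at f x <= bound_at g x.
Proof. by move=> fg; case: x => //=. Qed.

Lemma generalized_entropy_le (R : realType) (d : measure_display)
    (Z : measurableType d) (A : Type) (l : Z -> A -> R) (P : probability Z R)
    (a : A) :
  generalized_entropy l P <= 'E_P[fun z => l z a].
Proof. by apply: ereal_inf_lbound; exists a. Qed.

Lemma entropy_increase_le (R : realType) (d : measure_display)
    (Z : measurableType d) (A : Type) (l : Z -> A -> R) (P Q : probability Z R)
    (b : \bar R) (phi : R -> R) (aQ : A) :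
  generalized_entropy l Q = 'E_Q[fun z => l z aQ] -> 0 < b ->
  Q.-integrable setT (EFin \o (fun z => l z aQ)) ->
  (forall lambda : R, (0 <= lambda)%R -> lambda%:E < b ->
     centered_cgf Q (fun z => l z aQ) lambda <= (phi lambda)%:E) ->
  generalized_entropy l P - generalized_entropy l Q
  <= bound_at (conjugate_inv b phi) (kl_divergence P Q).
Proof.
move=> -> b0 intQ cgf; apply: le_trans (expectation_gap_le P b0 intQ cgf).
by apply: leeB => //; exact: generalized_entropy_le.
Qed.

(** The gap bound is applied to the negated loss, which turns the exponent [lambda] into [- lambda].
    The risk of [aP] under P may be infinite, and [defP] is what lets the sign pass through it. *)
Lemma entropy_decrease_le (R : realType) (d : measure_display)
    (Z : measurableType d) (A : Type) (l : Z -> A -> R) (P Q : probability Z R)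
    (b : \bar R) (phi : R -> R) (aP : A) :
  expectation_defined P (fun z => l z aP) ->
  generalized_entropy l P = 'E_P[fun z => l z aP] -> 0 < b ->
  Q.-integrable setT (EFin \o (fun z => l z aP)) ->
  (forall lambda : R, (0 <= lambda)%R -> lambda%:E < b ->
     centered_cgf Q (fun z => l z aP) (- lambda) <= (phi lambda)%:E) ->
  generalized_entropy l Q - generalized_entropy l P
  <= bound_at (conjugate_inv b phi) (kl_divergence P Q).
Proof.
move=> defP -> b0 intQ cgf.
have intQN : Q.-integrable setT (EFin \o (fun z => - l z aP)%R).
  by have := integrableN intQ; apply: eq_integrable.
apply: (@le_trans _ _ ('E_P[fun z => - l z aP]%R - 'E_Q[fun z => - l z aP]%R)).
  rewrite (expectationN defP).
  rewrite (expectationN (integrable_expectation_defined intQ)) oppeK addeC.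
  by apply: leeD => //; exact: generalized_entropy_le.
apply: expectation_gap_le => // lambda l0 lb.
by rewrite centered_cgfN// cgf.
Qed.

Theorem theorem2 (R : realType) (d : measure_display) (Z : measurableType d)
    (A : Type) (l : Z -> A -> R) (P Q : probability Z R) (aP aQ : A)
    (hP : forall a : A, expectation_defined P (fun z => l z a))
    (hQ : forall a : A, expectation_defined Q (fun z => l z a))
    (haP : generalized_entropy l P = 'E_P[fun z => l z aP])
    (haQ : generalized_entropy l Q = 'E_Q[fun z => l z aQ]) :
  (* (i) *)
  (forall sigmaQ : R, subgaussian Q (fun z => l z aQ) (sigmaQ ^+ 2) ->
     generalized_entropy l P - generalized_entropy l Q
     <= bound_at (fun D => (Num.sqrt (2 * sigmaQ ^+ 2 * D))%:E)
          (kl_divergence P Q)) /\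
  (forall sigmaP : R, subgaussian Q (fun z => l z aP) (sigmaP ^+ 2) ->
     generalized_entropy l Q - generalized_entropy l P
     <= bound_at (fun D => (Num.sqrt (2 * sigmaP ^+ 2 * D))%:E)
          (kl_divergence P Q)) /\
  (forall (bQ bP : \bar R) (phiQ phiP : R -> R), 0 < bQ -> 0 < bP ->
     (* (ii) *)
     (Q.-integrable setT (EFin \o (fun z => l z aQ)) ->
      (forall lambda : R, (0 <= lambda)%R -> lambda%:E < bQ ->
         centered_cgf Q (fun z => l z aQ) lambda <= (phiQ lambda)%:E) ->
      generalized_entropy l P - generalized_entropy l Q
      <= bound_at (conjugate_inv bQ phiQ) (kl_divergence P Q)) /\
     (Q.-integrable setT (EFin \o (fun z => l z aP)) ->
      (forall lambda : R, (0 <= lambda)%R -> lambda%:E < bP ->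
         centered_cgf Q (fun z => l z aP) (- lambda) <= (phiP lambda)%:E) ->
      generalized_entropy l Q - generalized_entropy l P
      <= bound_at (conjugate_inv bP phiP) (kl_divergence P Q)) /\
     (* (iii) *)
     (strictly_convex_on0 bQ phiQ -> phiQ 0%R = 0%R ->
      is_right_derivative0 phiQ 0 ->
      conjugate_inv bQ phiQ x @[x --> (0 : R)^'+] --> (0 : \bar R)) /\
     (strictly_convex_on0 bP phiP -> phiP 0%R = 0%R ->
      is_right_derivative0 phiP 0 ->
      conjugate_inv bP phiP x @[x --> (0 : R)^'+] --> (0 : \bar R))).
Proof.
split; [|split].
- move=> sigma sub; have [intQ _] := sub.
  have bound := bound_at_le (kl_divergence P Q)
    (fun D => conjugate_inv_quadratic_le D (sqr_ge0 sigma)).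
  apply: le_trans bound.
  apply: (entropy_increase_le P haQ (ltry 0) intQ) => lambda _ _.
  exact: subgaussian_centered_cgf sub _.
- move=> sigma sub; have [intQ _] := sub.
  have bound := bound_at_le (kl_divergence P Q)
    (fun D => conjugate_inv_quadratic_le D (sqr_ge0 sigma)).
  apply: le_trans bound.
  apply: (entropy_decrease_le (hP aP) haP (ltry 0) intQ) => lambda _ _.
  (* The quadratic bound is even in [lambda], so it also serves for the exponents [- lambda]. *)
  rewrite -(sqrrN lambda); exact: subgaussian_centered_cgf sub _.
- move=> bQ bP phiQ phiP bQ0 bP0; split; [|split; [|split]].
  + exact: entropy_increase_le.
  + exact: entropy_decrease_le.
  + exact: conjugate_inv_cvg0.
  + exact: conjugate_inv_cvg0.
Qed.
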